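(* Let $d\ge 1$ be an integer, $0<\lambda<\mu$, and let $\pi_0\in(0,1]$ be the equilibrium probability that the dispatcher's memory is empty. Let $R$ be the response time of the SQ($d$) policy with memory, with exponential job sizes with mean $1/\mu$ and arrival rate $\lambda$ (for the queue at the cavity in equilibrium). Let $\tilde R$ be the response time for the same system without memory (i.e. the classic SQ($d$) policy with exponential job sizes of mean $1/\mu$), but with arrival rate $\lambda\pi_0^{1/d}$. Then $R$ and $\tilde R$ have the same distribution.
   Context: Queue at the cavity for SQ($d$) with memory, arrival rate $\lambda$, empty-memory probability $\pi_0$, exponential job sizes with mean $1/\mu$, in equilibrium. It is a single first-come-first-served queue whose number of jobs $X$ evolves as a continuous-time Markov process on $\{0,1,2,\dots\}$. Let $u_k=\mathbb{P}(X\ge k)$ denote its equilibrium tail probabilities ($u_0=1$, $u_k\to0$). - Potential arrivals occur at rate $\lambda d\pi_0$. At a potential arrival, $d-1$ i.i.d. queue lengths with the equilibrium law of $X$ are drawn, independent of $X$; the job joins the queue at the cavity iff its queue length is the smallest of the $d$ values, ties being broken uniformly at random. Thus in state $k$ these arrivals join at rate $\lambda\pi_0\,(u_k^d-u_{k+1}^d)/(u_k-u_{k+1})$ (when $u_k>u_{k+1}$). - When the queue is empty there is an additional arrival rate $\lambda(1-\pi_0)/(1-u_1)$ (jobs routed to an idle server whose id is in memory). - When nonempty, departures occur at rate $\mu$. The equilibrium law is a probability law that is stationary for this process, with the rates computed from that same law. Response time $R$ (time from arrival until service completion) of an arriving job: with probability $1-\pi_0$ the job is sent to an idle server; with probability $\pi_0$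 the job joins a shortest one among $d$ independent queues each in the equilibrium law of $X$. A job joining a queue containing $k$ jobs has as response time a sum of $k+1$ independent exponential variables with mean $1/\mu$. The system without memory with arrival rate $\lambda'$ is the same model with $\lambda$ replaced by $\lambda'$ and $\pi_0$ replaced by $1$. *)

(* Defs.v *)
From HB Require Import structures.
From mathcomp Require Import all_boot all_order all_algebra.
From mathcomp Require Import all_classical all_reals all_analysis.
From mathcomp Require Import ring.

Set Implicit Arguments.
Unset Strict Implicit.
Unset Printing Implicit Defensive.

Import Order.TTheory GRing.Theory Num.Theory.
Import numFieldNormedType.Exports.

Local Open Scope classical_set_scope.
Local Open Scope ring_scope.

Section markov.
Variable R : realType.

(* [Pt t i] is the law at time [t] of the chain started in state [i]; only the
   times [0 <= t] matter. [Q] is the matrix of jump rates, with minus the total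
   exit rates on its diagonal. *)
Record is_transition_function (Q : nat -> nat -> R)
    (Pt : R -> nat -> probability nat R) : Prop := IsTransitionFunction {
  transition0 : forall i j, Pt 0 i [set j] = (i == j)%:R%:E ;
  transitionD : forall s t, 0 <= s -> 0 <= t -> forall i k,
    Pt (s + t) i [set k] =
      (\sum_(0 <= j <oo) Pt s i [set j] * Pt t j [set k])%E ;
  transition_rate : forall i j,
    (fine (Pt h i [set j]) - (i == j)%:R) / h @[h --> 0^'+] --> Q i j }.

Definition stationary_law (Q : nat -> nat -> R) (p : probability nat R) : Prop :=
  exists2 Pt, is_transition_function Q Pt &
    forall t, 0 <= t -> forall k,
      (\sum_(0 <= i <oo) p [set i] * Pt t i [set k])%E = p [set k].

End markov.

Section cavity.
Variable R : realType.
Implicit Types (p : probability nat R) (d k i j : nat).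

Definition mass p k : R := fine (p [set k]).

Definition tail p k : R := fine (p [set n | (k <= n)%N]).

(* The probability that a queue of length [k] is selected against [d.-1]
   independent lengths of law [p]: exactly [j] of these equal [k], the other
   ones are larger, and the tie between [j.+1] queues is broken uniformly. *)
Definition join_prob d p k : R :=
  \sum_(j < d) ('C(d.-1, j)%:R * mass p k ^+ j * tail p k.+1 ^+ (d.-1 - j))
    / j.+1%:R.

(* In state 0 the second term is the rate of jobs routed to an idle server
   whose id is in memory; [1 - tail p 1] is the probability of being idle,
   which is nonzero for every equilibrium law when [0 < mu]. *)
Definition arrival_rate d (lam pi0 : R) p k : R :=
  lam * d%:R * pi0 * join_prob d p k
  + (if k == 0%N then lam * (1 - pi0) / (1 - tail p 1) else 0).

Definition cavity_rates d (lam mu pi0 : R) p i j : R :=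
  if j == i.+1 then arrival_rate d lam pi0 p i
  else if i == j.+1 then mu
  else if i == j then
    - (arrival_rate d lam pi0 p i + (if i == 0%N then 0 else mu))
  else 0.

Definition equilibrium_law d (lam mu pi0 : R) p : Prop :=
  stationary_law (cavity_rates d lam mu pi0 p) p.

Lemma tailS p k : tail p k = mass p k + tail p k.+1.
Proof.
rewrite /tail /mass -fineD ?fin_num_measure//; congr fine.
rewrite -measureU//.
- congr (p _); apply/seteqP; split => n /=.
    by rewrite leq_eqVlt => /orP[/eqP->|]; [left|right].
  by case=> [->//|/ltnW].
- by apply/seteqP; split => // n [/= ->]; rewrite ltnn.
Qed.

(* The usual closed form of the joining rate, valid when [mass p k != 0]. *)
Lemma join_probE d p k : tail p k.+1 < tail p k ->
  d%:R * join_prob d p k =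
    (tail p k ^+ d - tail p k.+1 ^+ d) / (tail p k - tail p k.+1).
Proof.
move=> lt_u; apply: (canRL (mulfK _)); first by rewrite subr_eq0 gt_eqF.
have -> : tail p k - tail p k.+1 = mass p k by rewrite tailS addrK.
case: d => [|d]; first by rewrite mul0r !expr0 subrr mul0r.
rewrite {1}tailS [mass p k + _]addrC exprDn big_ord_recl /= subn0 bin0 expr0 mulr1 mulr1n.
rewrite [RHS]addrAC subrr add0r /join_prob mulr_sumr mulr_suml /=.
apply: eq_bigr => j _; rewrite /bump /= add1n subSS exprS -[RHS]mulr_natl.
have j0 : j.+1%:R != 0 :> R by rewrite pnatr_eq0.
have -> : 'C(d.+1, j.+1)%:R = d.+1%:R * 'C(d, j)%:R / j.+1%:R :> R.
  by rewrite -natrM (mul_bin_diag d.+1 j) natrM mulrAC mulfV// mul1r.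
move: j.+1%:R^-1 => c; rewrite -natr1; ring.
Qed.

End cavity.

Section independence.
Context (dT : measure_display) (T : measurableType dT) (R : realType).
Variable P : probability T R.

Definition mutually_independent (I : eqType) (F : I -> set (set T)) : Prop :=
  forall (s : seq I) (E : I -> set T), uniq s ->
    (forall i, i \in s -> F i (E i)) ->
    P (\bigcap_(i in [set` s]) E i) = (\prod_(i <- s) P (E i))%E.

Definition events_of (dU : measure_display) (U : measurableType dU)
  (X : T -> U) : set (set T) := preimage_set_system setT X measurable.

End independence.

Section response_time.
Context (dT : measure_display) (T : measurableType dT) (R : realType).
Variable P : probability T R.

(* [M] tells whether the memory is empty, [L i] is the length of the [i]-th
   sampled queue, [J] is the index of the selected queue (no assumption on how
   ties are broken) and [S 0, S 1, ...] are the exponential times: the first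
   [k.+1] of them are summed when the joined queue contains [k] jobs. *)
Definition is_response_time (d : nat) (mu pi0 : R) (p : probability nat R)
    (X : {RV P >-> R}) : Prop :=
  exists (M : {RV P >-> bool}) (L : 'I_d -> {RV P >-> nat})
         (S : nat -> {RV P >-> R}) (J : T -> 'I_d),
  [/\ mutually_independent P
        (fun a : unit + 'I_d + nat => match a with
          | inl (inl _) => events_of M
          | inl (inr i) => events_of (L i)
          | inr n => events_of (S n)
          end),
      distribution P M [set true] = pi0%:E,
      (forall i (A : set nat), measurable A -> distribution P (L i) A = p A)
        /\ (forall n (A : set R), measurable A ->
              distribution P (S n) A = exponential_prob mu A),
      forall w i, (L (J w) w <= L i w)%N &
      forall w, X w =
        \sum_(0 <= n < (if M w then L (J w) w else 0%N).+1) S n w].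

End response_time.

(* Main.v *)
(* Write u_k for the equilibrium tails. Differentiating stationarity at time 0
   gives, for each state, that the inflow is at most the outflow; hence the net
   flow from k to k+1 is nonnegative and nondecreasing in k, and being at most
   lam pi0 u_k it vanishes. The resulting balance equations telescope to
   mu u_1 = lam and mu u_{k+1} = lam pi0 u_k^d for k >= 1, so the tails of the
   memoryless system with arrival rate lam pi0^{1/d} are pi0^{1/d} u_k. The
   joined queue has length at least k >= 1 with probability pi0 u_k^d, which is
   therefore the same in both systems; the service times being independent of
   that length, the laws of the random sums agree. *)

Require Import Defs.
From HB Require Import structures.
From mathcomp Require Import all_boot all_order all_algebra.
From mathcomp Require Import all_classical all_reals all_analysis.
From mathcomp Require Import ring lra.

Import Order.TTheory GRing.Theory Num.Theory.
Import numFieldNormedType.Exports.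

Local Open Scope classical_set_scope.
Local Open Scope ring_scope.

(** * Tail and point probabilities of a queue-length law *)

Section tails.
Context {R : realType}.
Implicit Types (p : probability nat R) (d k n : nat).

Lemma mass_ge0 p k : 0 <= mass p k.
Proof. exact: fine_ge0. Qed.

Lemma massE p k : p [set k] = (mass p k)%:E.
Proof. by rewrite /mass fineK// fin_num_measure. Qed.

Lemma tail_ge0 p k : 0 <= tail p k.
Proof. exact: fine_ge0. Qed.

Lemma tailE p k : p [set n | (k <= n)%N] = (tail p k)%:E.
Proof. by rewrite /tail fineK// fin_num_measure. Qed.

Lemma tail_le1 p k : tail p k <= 1.
Proof. by rewrite -lee_fin -tailE probability_le1. Qed.

Lemma tail0 p : tail p 0 = 1.
Proof.
by apply: EFin_inj; rewrite -tailE -(@probability_setT _ _ _ p); congr (p _);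
  apply/seteqP; split.
Qed.

Lemma tail_cvg0 p : tail p k @[k --> \oo] --> 0.
Proof.
have cap0 : \bigcap_k [set n | (k <= n)%N] = set0 :> set nat.
  by apply/seteqP; split => // n /(_ n.+1 I) /=; rewrite ltnn.
apply: (@fine_cvg _ _ _ _ (fun k => p [set n | (k <= n)%N])).
rewrite -[0%:E]/(0%E) -(@measure0 _ _ _ p) -cap0.
apply: (@nonincreasing_cvg_mu _ _ _ p (fun k => [set n | (k <= n)%N])) => //.
- by rewrite -ge0_fin_numE// fin_num_measure.
- by move=> m k mk; apply/subsetPset => n /=; exact: leq_trans.
Qed.

(** Multiplying by [mass p k] clears the denominator of the closed form, so that the identity also
    covers states of mass zero, where the two tails coincide and both sides vanish. *)
Lemma mass_join_prob d p k :
  d%:R * (mass p k * join_prob d p k) = tail p k ^+ d - tail p k.+1 ^+ d.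
Proof.
have uE := tailS p k.
have [m0|m0] := eqVneq (mass p k) 0.
  by rewrite m0 mul0r mulr0 uE m0 add0r subrr.
have lt_u : tail p k.+1 < tail p k by rewrite uE ltrDr lt0r m0 mass_ge0.
have mE : mass p k = tail p k - tail p k.+1 by rewrite uE addrK.
by rewrite mulrCA join_probE// {1}mE mulrC divfK// subr_eq0 gt_eqF.
Qed.

End tails.

(** * Flow inequality for a stationary law *)

Section stationary.
Context {R : realType}.
Implicit Types (p : probability nat R) (Q : nat -> nat -> R).

(* The truncation at [n] makes the exchange of the sum with the derivative at
   time 0 immediate; only an inequality is left. *)
Lemma stationary_inflow_le {Q p} [n k] : stationary_law Q p -> (k < n)%N ->
  \sum_(0 <= i < n) mass p i * Q i k <= 0.
Proof.
move=> [Pt [_ _ rate] inv] kn.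
have cvQ : \sum_(0 <= i < n)
    mass p i * ((fine (Pt h i [set k]) - (i == k)%:R) / h) @[h --> 0^'+] -->
    \sum_(0 <= i < n) mass p i * Q i k.
  apply: cvg_big => [|i _]; first exact: add_continuous.
  by apply: cvgM; [exact: cvg_cst|exact: rate].
apply: (cvgr_to_le cvQ); near=> h.
have h0 : 0 < h by near: h; exact: nbhs_right_gt.
(* Stationarity at time [h]: a partial sum of nonnegative terms is at most the whole series, which
   is [mass p k]. *)
have le_p : \sum_(0 <= i < n) mass p i * mass (Pt h i) k <= mass p k.
  rewrite -lee_fin -sumEFin -massE -(inv h (ltW h0) k).
  under eq_bigr do rewrite EFinM -!massE.
  by apply: nneseries_lim_ge => i _; rewrite mule_ge0.
under eq_bigr do rewrite mulrA.
rewrite -mulr_suml pmulr_lle0 ?invr_gt0//.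
under eq_bigr do rewrite mulrBr.
rewrite sumrB subr_le0 (le_trans le_p)// big_mkord.
rewrite (bigD1 (Ordinal kn))//= eqxx mulr1 lerDl sumr_ge0// => i _.
by rewrite mulr_ge0// mass_ge0.
Unshelve. all: by end_near. Qed.

End stationary.

(** * Balance equations and equilibrium tails of the cavity queue *)

Section cavity.
Context {R : realType}.
Variables (d : nat) (lam mu pi0 : R) (p : probability nat R).
Hypotheses (d_gt0 : (0 < d)%N) (lam_ge0 : 0 <= lam) (mu_gt0 : 0 < mu).
Hypothesis pi0_ge0 : 0 <= pi0.
Hypothesis eqp : equilibrium_law d lam mu pi0 p.

Let flow k : R := mass p k * arrival_rate d lam pi0 p k - mu * mass p k.+1.

(** Jumps only link neighbouring states, so a truncation just past the right neighbour keeps all the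
    inflow. State 0 gives the sign of [flow 0], and state [k.+1] gives the monotonicity. *)
Let flow_nd k : 0 <= flow 0 /\ flow k <= flow k.+1.
Proof.
split.
  have := stationary_inflow_le eqp (isT : (0 < 2)%N).
  rewrite !big_nat_recr//= big_geq// /cavity_rates /flow /=; lra.
have := stationary_inflow_le eqp (leqnSn k.+2).
rewrite !big_nat_recr//= big_nat big1 => [|i /= ik]; last first.
  rewrite /cavity_rates eqSS [k == i]gtn_eqF// ltn_eqF; last exact: ltnW (ltnW _).
  by rewrite ltn_eqF ?mulr0//; exact: ltnW.
rewrite /cavity_rates !eqxx !eqSS (ltn_eqF (ltnSn k)) (ltn_eqF (leqnSn k.+1)) /=.
rewrite /flow; lra.
Qed.

(** Away from state 0 there is no memory term, and mass times joining rate is [lam * pi0] times a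
    difference of [d]-th powers of tails; the first power is at most the tail itself because
    [0 < d]. *)
Let flow_le k : flow k.+1 <= lam * pi0 * tail p k.+1.
Proof.
rewrite /flow /arrival_rate /= addr0.
have := mass_join_prob d p k.+1; set m := mass p k.+1; set j := join_prob _ _ _.
move=> mj.
have -> : m * (lam * d%:R * pi0 * j) = lam * pi0 * (d%:R * (m * j)).
  by rewrite mulrCA; lra.
rewrite mj.
have uv : tail p k.+1 ^+ d - tail p k.+2 ^+ d <= tail p k.+1.
  rewrite lerBlDr -[d]prednK// exprSr ler_wpDr ?mulr_ge0 ?exprn_ge0 ?tail_ge0//.
  rewrite ler_piMl ?tail_ge0// exprn_ile1 ?tail_ge0 ?tail_le1//.
have := ler_wpM2l (mulr_ge0 lam_ge0 pi0_ge0) uv.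
have := mulr_ge0 (ltW mu_gt0) (mass_ge0 p k.+2); lra.
Qed.

(** By monotonicity [flow k] lies between 0 and every later flow, and the bound on the latter tends
    to 0 with the tails. *)
Lemma equilibrium_balance k :
  mass p k * arrival_rate d lam pi0 p k = mu * mass p k.+1.
Proof.
have flow_homo : {homo flow : m n / (m <= n)%N >-> m <= n}.
  by apply: homo_leq => // [x y z|n]; [exact: le_trans|have [] := flow_nd n].
have flow_ge0 : 0 <= flow k.
  by have [f0 _] := flow_nd 0; rewrite (le_trans f0)// flow_homo.
apply/eqP; rewrite -subr_eq0 -/(flow k) eq_le flow_ge0 andbT.
have cv : lam * pi0 * tail p n @[n --> \oo] --> lam * pi0 * 0.
  by apply: cvgM; [exact: cvg_cst|exact: tail_cvg0].
have le_tail n : (k < n)%N -> flow k <= lam * pi0 * tail p n.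
  by case: n => // n kn; rewrite (le_trans (flow_homo _ _ (ltnW kn))).
rewrite mulr0 in cv; apply: (cvgr_to_ge cv); near=> n.
by apply: le_tail; near: n; exact: nbhs_infty_gt.
Unshelve. all: by end_near. Qed.

(** Masses are differences of tails, so balance at [n.+1] says that [g n.+1 = g n]; the constant
    value of [g] is its limit, which is 0. *)
Lemma equilibrium_tailSS k : mu * tail p k.+2 = lam * pi0 * tail p k.+1 ^+ d.
Proof.
pose g n := lam * pi0 * tail p n.+1 ^+ d - mu * tail p n.+2.
have gE n : g n = g 0.
  elim: n => // n <-; rewrite /g.
  have := equilibrium_balance n.+1.
  rewrite /arrival_rate /= addr0 => bal.
  have mj := mass_join_prob d p n.+1.
  have uE := tailS p n.+2.
  have : lam * pi0 * (d%:R * (mass p n.+1 * join_prob d p n.+1)) =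
         mu * mass p n.+2 by rewrite -bal; ring.
  rewrite mj; nra.
have cv : g n @[n --> \oo] --> lam * pi0 * 0 ^+ d - mu * 0.
  have cvS m : tail p (n + m) @[n --> \oo] --> 0.
    by rewrite (cvg_shiftn m (tail p)); exact: tail_cvg0.
  apply: cvgB; apply: cvgM; try exact: cvg_cst.
    apply: (@cvg_comp _ _ _ (fun n => tail p n.+1) (fun x : R => x ^+ d)).
      by under eq_fun do rewrite -addn1; exact: cvS.
    exact: exprn_continuous.
  by under eq_fun do rewrite -addn2; exact: cvS.
have g0 : g 0 = 0.
  apply: (@cvg_unique _ _ (g n @[n --> \oo])) => //.
    by apply: cvg_near_cst; apply: nearW => n; rewrite gE.
  (* Here [0 < d] enters: it makes [0 ^+ d] vanish. *)
  by move: cv; rewrite expr0n gtn_eqF// !mulr0 subrr.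
by have := gE k; rewrite g0 /g; lra.
Qed.

(** Were it zero, balance would propagate zero mass to every state and all tails would equal 1
    instead of tending to 0. This justifies the division by [1 - tail p 1] in the rate at state
    0. *)
Lemma equilibrium_mass0_neq0 : mass p 0 != 0.
Proof.
apply/eqP => m0.
have mass0 k : mass p k = 0.
  elim: k => // k mk; have := equilibrium_balance k.
  by rewrite mk mul0r => /esym/eqP; rewrite mulf_eq0 gt_eqF//= => /eqP.
have tail1 k : tail p k = 1.
  by elim: k => [|k <-]; [exact: tail0|rewrite (tailS p k) mass0 add0r].
have : 1 <= 0 :> R.
  by apply: (cvgr_to_ge (tail_cvg0 p)); apply: nearW => k; rewrite tail1.
by rewrite ler10.
Qed.

(** Balance at 0 reads [lam * pi0 * (1 - u1 ^+ d) + lam * (1 - pi0) = mu * (u1 - u2)], and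
    [mu * u2 = lam * pi0 * u1 ^+ d] cancels the powers. *)
Lemma equilibrium_tail1 : mu * tail p 1 = lam.
Proof.
have := equilibrium_balance 0; have := equilibrium_tailSS 0.
have := mass_join_prob d p 0; have := tailS p 1; have := tailS p 0.
have := equilibrium_mass0_neq0.
rewrite /arrival_rate eqxx tail0 expr1n => m0 u0 u1 mj u2.
have -> : 1 - tail p 1 = mass p 0 by lra.
have -> : mass p 0 * (lam * d%:R * pi0 * join_prob d p 0
                      + lam * (1 - pi0) / mass p 0) =
          lam * pi0 * (d%:R * (mass p 0 * join_prob d p 0)) + lam * (1 - pi0).
  by field.
rewrite mj; nra.
Qed.

End cavity.

(** With [c ^+ d = pi0], both recursions give by induction that the positive-index tails of [p'] are
    [c] times those of [p]. The [d]-th powers are what the minimum of [d] independent lengths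
    involves. *)
Lemma tail_scaling {R : realType} {d : nat} {lam mu pi0 : R}
    {p p' : probability nat R} :
  (0 < d)%N -> 0 < lam -> 0 < mu -> 0 < pi0 ->
  equilibrium_law d lam mu pi0 p ->
  equilibrium_law d (lam * pi0 `^ d%:R^-1) mu 1 p' ->
  forall k, tail p' k.+1 ^+ d = pi0 * tail p k.+1 ^+ d.
Proof.
move=> d_gt0 lam_gt0 mu_gt0 pi0_gt0 eqp eqp' k.
set c := pi0 `^ d%:R^-1 in eqp' *.
have cd : c ^+ d = pi0.
  by rewrite -powR_mulrn ?powR_ge0// -powRrM mulVf ?powRr1 ?ltW// pnatr_eq0 -lt0n.
have lamc_ge0 : 0 <= lam * c by rewrite mulr_ge0 ?powR_ge0// ltW.
suff -> : tail p' k.+1 = c * tail p k.+1 by rewrite exprMn cd.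
have mu0 : mu != 0 by rewrite gt_eqF.
apply: (mulfI mu0); rewrite mulrCA; elim: k => [|k IH].
  rewrite (equilibrium_tail1 d _ _ _ _ d_gt0 lamc_ge0 mu_gt0 ler01 eqp').
  by rewrite (equilibrium_tail1 d _ _ _ _ d_gt0 (ltW lam_gt0) mu_gt0 (ltW pi0_gt0) eqp) mulrC.
rewrite (equilibrium_tailSS d _ _ _ _ d_gt0 lamc_ge0 mu_gt0 ler01 eqp').
rewrite (equilibrium_tailSS d _ _ _ _ d_gt0 (ltW lam_gt0) mu_gt0 (ltW pi0_gt0) eqp).
have -> : tail p' k.+1 = c * tail p k.+1 by apply: (mulfI mu0); rewrite IH mulrCA.
by rewrite exprMn cd; ring.
Qed.

(** * Finite measures on tuples are determined by boxes *)

Section boxes.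
Context {d : measure_display} {U : measurableType d} {R : realType}.
Variable n : nat.

Let box (B : 'I_n -> set U) : set (n.-tuple U) :=
  [set t | forall i, B i (tnth t i)].

Let boxes : set (set (n.-tuple U)) :=
  [set box B | B in [set B | forall i, measurable (B i)]].

Let boxE B : box B = \big[setI/setT]_(i < n) ((@tnth n U ^~ i) @^-1` B i).
Proof.
rewrite -bigcap_seq; apply/seteqP; split => t /= h i; first by move=> _; exact: h.
by apply: (h i); rewrite /= mem_index_enum.
Qed.

Let measurable_box B : (forall i, measurable (B i)) -> measurable (box B).
Proof.
move=> mB; rewrite boxE; apply: bigsetI_measurable => i _.
by rewrite -[X in measurable X]setTI; exact: measurable_tnth.
Qed.

Let measurable_boxes : measurable = <<s boxes >>.
Proof.
apply/seteqP; split.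
  apply: smallest_sub; first exact: smallest_sigma_algebra.
  rewrite -bigcup_seq; apply: bigcup_sub => i _ _ [B mB <-].
  apply: sub_sigma_algebra.
  (* A constraint on the single coordinate [i] is a box whose other sides are the whole space. *)
  exists (fun j => if j == i then B else setT).
    by move=> j /=; case: ifP.
  rewrite setTI; apply/seteqP; split => t /=.
    by move=> /(_ i); rewrite eqxx.
  by move=> Bt j; case: eqP => [->|].
apply: smallest_sub; first exact: sigma_algebra_measurable.
by move=> _ [B mB <-]; exact: measurable_box.
Qed.

(** Boxes are closed under intersection and generate the product sigma-algebra; the whole space is
    itself a box, of finite measure. *)
Lemma measure_tuple_unique (m1 m2 : {measure set (n.-tuple U) -> \bar R}) :
  (m1 setT < +oo)%E ->
  (forall B : 'I_n -> set U, (forall i, measurable (B i)) ->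
    m1 [set t | forall i, B i (tnth t i)] =
    m2 [set t | forall i, B i (tnth t i)]) ->
  forall A, measurable A -> m1 A = m2 A.
Proof.
move=> m1oo m12 A mA.
have boxT : [set: n.-tuple U] = box (fun=> setT) by apply/seteqP; split.
apply: (measure_unique boxes (fun=> setT)) => //.
- move=> _ _ [B mB <-] [C mC <-]; exists (fun i => B i `&` C i).
    by move=> i; exact: measurableI.
  apply/seteqP; split => t /=; first by move=> BC; split=> i; have [] := BC i.
  by move=> [Bt Ct] i; split; [exact: Bt|exact: Ct].
- by move=> _; rewrite boxT; exists (fun=> setT).
- by rewrite bigcup_const.
- by move=> _ [B mB <-]; exact: m12.
Qed.

End boxes.

(** * Laws of sums with a fixed or random number of terms *)

Section sums.
Context {dT dT' : measure_display}.
Context {T : measurableType dT} {T' : measurableType dT'} {R : realType}.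
Variables (P : probability T R) (P' : probability T' R).
Variables (S : nat -> {RV P >-> R}) (S' : nat -> {RV P' >-> R}).

(** The restrictions of [P] to [E] and of [P'] to [E'], pushed forward to tuples, agree on boxes and
    hence everywhere, in particular on the preimage of [A] under the sum of coordinates. *)
Lemma eq_law_sum (n : nat) (E : set T) (E' : set T') :
  measurable E -> measurable E' ->
  (forall B : nat -> set R, (forall i, measurable (B i)) ->
    P (E `&` [set w | forall i, (i < n)%N -> B i (S i w)]) =
    P' (E' `&` [set w | forall i, (i < n)%N -> B i (S' i w)])) ->
  forall A, measurable A ->
    P (E `&` [set w | A (\sum_(0 <= i < n) S i w)]) =
    P' (E' `&` [set w | A (\sum_(0 <= i < n) S' i w)]).
Proof.
move=> mE mE' eqB A mA.
pose f w := [tuple S i w | i < n]; pose f' w := [tuple S' i w | i < n].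
have mf : measurable_fun setT f.
  apply/measurable_fun_tnthP => i; rewrite (_ : _ \o _ = S i)//.
  by apply/funext => w /=; rewrite tnth_mktuple.
have mf' : measurable_fun setT f'.
  apply/measurable_fun_tnthP => i; rewrite (_ : _ \o _ = S' i)//.
  by apply/funext => w /=; rewrite tnth_mktuple.
pose m1 : {measure set (n.-tuple R) -> \bar R} :=
  pushforward (mrestr P mE) f.
pose m2 : {measure set (n.-tuple R) -> \bar R} :=
  pushforward (mrestr P' mE') f'.
pose sum (t : n.-tuple R) : R := \sum_(i < n) tnth t i.
have msum : measurable_fun setT sum.
  by apply: measurable_sum => i; exact: measurable_tnth.
have sumE w : sum (f w) = \sum_(0 <= i < n) S i w.
  by rewrite big_mkord; apply: eq_bigr => i _; rewrite tnth_mktuple.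
have sumE' w : sum (f' w) = \sum_(0 <= i < n) S' i w.
  by rewrite big_mkord; apply: eq_bigr => i _; rewrite tnth_mktuple.
have : m1 mf (sum @^-1` A) = m2 mf' (sum @^-1` A).
  apply: measure_tuple_unique.
  - rewrite /m1 /= /pushforward /mrestr preimage_setT setTI.
    by rewrite -ge0_fin_numE// fin_num_measure.
  - move=> B mB; rewrite /m1 /m2 /= /pushforward /mrestr !(setIC _ E) !(setIC _ E').
    (* Extends the [n] sides to a family over all naturals; the value [setT] from [n] on is never
       tested. *)
    pose C k := if insub k is Some i then B i else setT.
    have mC k : measurable (C k) by rewrite /C; case: insubP.
    have CE (k : 'I_n) : C k = B k by rewrite /C valK.
    move: (eqB C mC); congr (_ = _); congr (_ (_ `&` _)).
      apply/seteqP; split => w /= h i.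
        by rewrite tnth_mktuple -CE; apply: h.
      by move=> ilt; have := h (Ordinal ilt); rewrite tnth_mktuple -CE.
    apply/seteqP; split => w /= h i.
      by rewrite tnth_mktuple -CE; apply: h.
    by move=> ilt; have := h (Ordinal ilt); rewrite tnth_mktuple -CE.
  - by rewrite -[X in measurable X]setTI; exact: msum.
rewrite /m1 /m2 /= /pushforward /mrestr !(setIC _ E) !(setIC _ E').
congr (_ = _); congr (_ (_ `&` _)); apply/seteqP; split => w /=;
  by rewrite ?sumE ?sumE'.
Qed.

End sums.

(** Splits along the value of [K], writing the event that [K] is [k] as a difference of two nested
    tail events, since it is the tail events whose joint law with the summands is accessible. *)
Lemma random_sum_law {dT : measure_display} {T : measurableType dT} {R : realType}
    (P : probability T R) (S : nat -> {RV P >-> R}) (K : T -> nat) :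
  (forall k, measurable [set w | (k <= K w)%N]) ->
  forall A, measurable A ->
  let sum k := [set w | A (\sum_(0 <= i < k.+1) S i w)] in
  P [set w | sum (K w) w] =
  (\sum_(0 <= k <oo) (P ([set w | (k <= K w)%N] `&` sum k)
                      - P ([set w | (k.+1 <= K w)%N] `&` sum k)))%E.
Proof.
move=> mK A mA sum.
have msum k : measurable (sum k).
  have mS : measurable_fun setT (fun w => \sum_(0 <= i < k.+1) S i w).
    by apply: measurable_sum => i; exact: measurable_funPT.
  by rewrite -[sum k]setTI; exact: mS.
pose F k := ([set w | (k <= K w)%N] `\` [set w | (k.+1 <= K w)%N]) `&` sum k.
have mF k : measurable (F k) by apply: measurableI => //; exact: measurableD.
have FE k w : F k w <-> K w = k /\ sum k w.
  split=> [[[/= kK /negP]]|[Kk sk]].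
    by rewrite -leqNgt => Kk sk; split => //; apply/eqP; rewrite eqn_leq Kk.
  by split => //; split => /=; rewrite Kk ?ltnn.
have -> : [set w | sum (K w) w] = \bigcup_k F k.
  apply/seteqP; split => w /=; first by move=> sw; exists (K w) => //; apply/FE.
  by move=> [k _ /FE[-> ]].
rewrite measure_semi_bigcup//; last 2 first.
- by move=> i j _ _ [w [/FE[<- _] /FE[<- _]]].
- exact: bigcupT_measurable.
have mKs k : measurable ([set w | (k <= K w)%N] `&` sum k) by exact: measurableI.
apply: eq_eseriesr => k _; rewrite /F setIDAC setIDA measureD ?mKs//; last first.
  by rewrite -ge0_fin_numE// fin_num_measure.
congr (_ - P _)%E; rewrite setIAC; congr (_ `&` _).
by apply/setIidr => w /= /ltnW.
Qed.

Lemma eq_law_random_sum {dT dT' : measure_display}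
    {T : measurableType dT} {T' : measurableType dT'} {R : realType}
    (P : probability T R) (P' : probability T' R)
    (S : nat -> {RV P >-> R}) (S' : nat -> {RV P' >-> R})
    (K : T -> nat) (K' : T' -> nat) :
  (forall k, measurable [set w | (k <= K w)%N]) ->
  (forall k, measurable [set w | (k <= K' w)%N]) ->
  (forall k n (B : nat -> set R), (forall i, measurable (B i)) ->
    P ([set w | (k <= K w)%N] `&` [set w | forall i, (i < n)%N -> B i (S i w)]) =
    P' ([set w | (k <= K' w)%N] `&` [set w | forall i, (i < n)%N -> B i (S' i w)])) ->
  forall A, measurable A ->
    P [set w | A (\sum_(0 <= i < (K w).+1) S i w)] =
    P' [set w | A (\sum_(0 <= i < (K' w).+1) S' i w)].
Proof.
move=> mK mK' eqK A mA; rewrite (random_sum_law P S K)// (random_sum_law P' S' K')//.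
by apply: eq_eseriesr => k _; congr (_ - _)%E; apply: eq_law_sum => // B; exact: eqK.
Qed.

(** * Joint law of the joined queue length and the service times *)

Section response_time.
Context {dT : measure_display} {T : measurableType dT} {R : realType}.
Variables (P : probability T R) (d : nat) (mu pi0 : R) (p : probability nat R).
Variables (M : {RV P >-> bool}) (L : 'I_d -> {RV P >-> nat}).
Variables (S : nat -> {RV P >-> R}) (J : T -> 'I_d).
Hypothesis indep : mutually_independent P
  (fun a : unit + 'I_d + nat => match a with
    | inl (inl _) => events_of M
    | inl (inr i) => events_of (L i)
    | inr n => events_of (S n)
    end).
Hypothesis lawM : distribution P M [set true] = pi0%:E.
Hypothesis lawL : forall i (A : set nat), measurable A ->
  distribution P (L i) A = p A.
Hypothesis lawS : forall n (A : set R), measurable A ->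
  distribution P (S n) A = exponential_prob mu A.
Hypothesis minJ : forall w i, (L (J w) w <= L i w)%N.

Let joined w := if M w then L (J w) w else 0%N.

(* [J] itself need not be measurable, but the minimal length is. *)
Lemma joined_geE k : [set w | (k.+1 <= joined w)%N] =
  M @^-1` [set true] `&` \bigcap_(i in [set: 'I_d]) (L i @^-1` [set n | (k.+1 <= n)%N]).
Proof.
apply/seteqP; split => w /=; rewrite /joined; last first.
  by move=> [-> h]; exact: h.
by case: (M w) => // h; split=> // i _; exact: leq_trans (minJ w i).
Qed.

Lemma measurable_joined_ge k : measurable [set w | (k <= joined w)%N].
Proof.
case: k => [|k]; first by rewrite (_ : [set _ | _] = setT)//; apply/seteqP; split.
rewrite joined_geE; apply: measurableI.
  by rewrite -[X in measurable X]setTI; exact: measurable_funPT.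
apply: fin_bigcap_measurable => // i _.
by rewrite -[X in measurable X]setTI; exact: measurable_funPT.
Qed.

(** For positive [k] the event demands an empty memory and all [d] lengths at least [k], so
    independence factors everything. For [k = 0] it always holds, idle routing included, whence the
    separate value 1. *)
Lemma joined_ge_services k n (B : nat -> set R) : (forall i, measurable (B i)) ->
  P ([set w | (k <= joined w)%N] `&` [set w | forall i, (i < n)%N -> B i (S i w)]) =
  ((if k is _.+1 then pi0 * tail p k ^+ d else 1)%:E *
   \prod_(0 <= i < n) exponential_prob mu (B i))%E.
Proof.
move=> mB.
(* The default [set0] is never reached: the list contains only service indices. *)
have PS : (\prod_(i <- map (@inr (unit + 'I_d) nat) (iota 0 n))
    P (if i is inr j then S j @^-1` B j else set0) =
    \prod_(0 <= i < n) exponential_prob mu (B i))%E.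
  by rewrite big_map /index_iota subn0; apply: eq_bigr => i _; rewrite -(lawS i).
have evS j : events_of (S j) (S j @^-1` B j).
  by exists (B j) => //; rewrite setTI.
case: k => [|k].
  rewrite mul1e -PS.
  rewrite -(indep (map inr (iota 0 n))
    (fun i => if i is inr j then S j @^-1` B j else set0)).
  - congr (P _); apply/seteqP; split => w /=.
      by move=> [_ h] a /mapP[i]; rewrite mem_iota => /h Bi ->.
    move=> h; split => // i ilt; apply: (h (inr i)).
    by rewrite /= map_f// mem_iota.
  - by rewrite map_inj_uniq ?iota_uniq// => ? ? [].
  - by move=> _ /mapP[i _ ->].
pose E (a : unit + 'I_d + nat) : set T := match a with
  | inl (inl _) => M @^-1` [set true]
  | inl (inr i) => L i @^-1` [set n | (k.+1 <= n)%N]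
  | inr n => S n @^-1` B n
  end.
(* The indices of the memory and of all sampled queues, to be followed by the first [n] services. *)
pose s1 : seq (unit + 'I_d + nat) :=
  inl (inl tt) :: map (fun i => inl (inr i)) (index_enum 'I_d).
have -> : [set w | (k.+1 <= joined w)%N] `&`
    [set w | forall i, (i < n)%N -> B i (S i w)] =
    \bigcap_(a in [set` s1 ++ map inr (iota 0 n)]) E a.
  rewrite joined_geE; apply/seteqP; split => w /=.
    move=> [[Mw Lw] Sw] a; rewrite /= inE mem_cat => /or3P[/eqP->//||].
      by move=> /mapP[i _ ->]; exact: Lw.
    by move=> /mapP[i]; rewrite mem_iota => /Sw Bi ->.
  move=> h; split; first split.
  - by apply: (h (inl (inl tt))); rewrite /= mem_head.
  - move=> i _; apply: (h (inl (inr i))).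
    by rewrite /= inE mem_cat map_f ?orbT// mem_index_enum.
  - move=> i ilt; apply: (h (inr i)).
    by rewrite /= inE mem_cat (map_f inr) ?orbT// mem_iota.
rewrite indep.
- rewrite big_cat -PS !big_map big_cons big_map /=; congr (_ * _)%E.
  rewrite EFinM -lawM; congr (_ * _)%E.
  rewrite (eq_bigr (fun=> (tail p k.+1)%:E)) => [|i _].
    by rewrite prodEFin prodr_const card_ord.
  by rewrite -tailE -(lawL i).
- rewrite cat_uniq /= !map_inj_uniq ?iota_uniq ?index_enum_uniq ?andbT//=;
    try by move=> ? ? [].
  apply/andP; split; first by apply/mapP => -[].
  by apply/hasPn => _ /mapP[i _ ->]; rewrite inE /=; apply/mapP => -[].
- move=> [[[]|i]|j] _ //=.
    by exists [set true] => //; rewrite setTI.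
  by exists [set n0 | (k.+1 <= n0)%N] => //; rewrite setTI.
Qed.

End response_time.

(** * Equality of the two response-time laws *)

Theorem theorem2 (R : realType) (d : nat) (lam mu pi0 : R)
    (p p' : probability nat R)
    (dT dT' : measure_display) (T : measurableType dT) (T' : measurableType dT')
    (P : probability T R) (P' : probability T' R)
    (X : {RV P >-> R}) (X' : {RV P' >-> R}) :
  (1 <= d)%N -> 0 < lam -> lam < mu -> 0 < pi0 -> pi0 <= 1 ->
  equilibrium_law d lam mu pi0 p ->
  is_response_time d mu pi0 p X ->
  equilibrium_law d (lam * pi0 `^ (d%:R^-1)) mu 1 p' ->
  is_response_time d mu 1 p' X' ->
  forall A : set R, measurable A -> distribution P X A = distribution P' X' A.
Proof.
move=> d_gt0 lam_gt0 lam_mu pi0_gt0 _ eqp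
  [M [L [S [J [indep lawM [lawL lawS] minJ XE]]]]] eqp'
  [M' [L' [S' [J' [indep' lawM' [lawL' lawS'] minJ' XE']]]]] A mA.
have tailE' := tail_scaling d_gt0 lam_gt0 (lt_trans lam_gt0 lam_mu) pi0_gt0 eqp eqp'.
rewrite /distribution /pushforward.
have -> : X @^-1` A = [set w |
    A (\sum_(0 <= n < (if M w then L (J w) w else 0%N).+1) S n w)].
  by apply/seteqP; split => w /=; rewrite XE.
have -> : X' @^-1` A = [set w |
    A (\sum_(0 <= n < (if M' w then L' (J' w) w else 0%N).+1) S' n w)].
  by apply/seteqP; split => w /=; rewrite XE'.
apply: eq_law_random_sum => // [k|k|k n B mB].
- exact: measurable_joined_ge.
- exact: measurable_joined_ge.
rewrite (joined_ge_services _ _ mu pi0 p)// (joined_ge_services _ _ mu 1 p')//.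
(* For positive lengths the two factors are [pi0 * tail p k.+1 ^+ d] and [1 * tail p' k.+1 ^+ d],
   equal by the scaling of tails. *)
by case: k => // k; rewrite mul1r tailE'.
Qed.
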